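(* Let $\mathcal C\subseteq\mathbb R^d$ be nonempty, compact and convex, and let $f\colon\mathbb R^d\to\mathbb R$ be convex, continuously differentiable and $L$-smooth on $\mathcal C$ for some $L>0$. Let $\mathcal M=\operatorname{argmin}_{x\in\mathcal C}f(x)$ and $f^\star=\min_{x\in\mathcal C}f(x)$. Let $(x_t)$ be the Frank--Wolfe iterates (from an arbitrary $x_0\in\mathcal C$) generated by the classical open-loop rule $\gamma_t=2/(t+2)$. Suppose that $\mathcal C$, together with its fixed LMO selector $S$, satisfies local dual sharpness around $\mathcal M$ with some constants $(A,q)$, where $A>0$ and $q\ge2$. Then $$f(x_t)-f^\star=o(1/t)\qquad(t\to\infty).$$
   Context: Norms are Euclidean. Coordinates are taken on the affine hull of $\mathcal C$; equivalently, the definitions are read relative to $\operatorname{aff}(\mathcal C)$, with directions and gradients projected to its linear span. $L$-smooth on $\mathcal C$: $f(y)\le f(x)+\langle\nabla f(x),y-x\rangle+\frac L2\|y-x\|^2$ for all $x,y\in\mathcal C$. LMO selector: a fixed deterministic map $S\colon\mathbb R^d\to\mathcal C$ with $S(g)\in\operatorname{argmin}_{s\in\mathcal C}\langle g,s\rangle$ for every $g$. Frank--Wolfe: given $x_0\in\mathcal C$, for $t=0,1,2,\dots$ set $s_t=S(\nabla f(x_t))$ and $x_{t+1}=x_t+\gamma_t(s_t-x_t)$. Local dual sharpness (LDS): for nonempty $M\subseteq\mathcal C$, $A>0$ and real $q\ge2$, $\mathcal C$ together with the selector $S$ satisfies local dual sharpness around $M$ with constants $(A,q)$ if there is $\rho>0$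 such that for every $x\in\mathcal C$ with $\operatorname{dist}(x,M)<\rho$ and every $g\in\mathbb R^d$, $$A\|g\|\,\|x-S(g)\|^q\le\langle g,x-S(g)\rangle .$$ *)

(* Defs.v *)
From HB Require Import structures.
From mathcomp Require Import all_boot all_order all_algebra.
From mathcomp Require Import all_classical all_reals all_analysis.
Set Implicit Arguments.
Unset Strict Implicit.
Unset Printing Implicit Defensive.
Import Order.TTheory GRing.Theory Num.Theory numFieldNormedType.Exports.
Local Open Scope classical_set_scope.
Local Open Scope ring_scope.

(* The library norm on 'rV[R]_d is the sup norm; only its topology (and hence
   compact, continuous, differentiable) is used.  Metric notions are stated
   with the Euclidean norm enorm. *)
Definition dot (R : realType) (d : nat) (u v : 'rV[R]_d) : R :=
  \sum_(i < d) u 0 i * v 0 i.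

Definition enorm (R : realType) (d : nat) (u : 'rV[R]_d) : R :=
  Num.sqrt (dot u u).

Definition dist (R : realType) (d : nat) (x : 'rV[R]_d) (M : set 'rV[R]_d) : R :=
  inf [set enorm (x - y) | y in M].

Definition grad (R : realType) (d : nat) (f : 'rV[R]_d -> R) (x : 'rV[R]_d) :
    'rV[R]_d :=
  \row_(i < d) 'D_(delta_mx 0 i) f x.

Definition continuously_differentiable (R : realType) (d : nat)
    (f : 'rV[R]_d -> R) : Prop :=
  (forall x, differentiable f x) /\ continuous (grad f).

Definition smooth_on (R : realType) (d : nat) (C : set 'rV[R]_d) (L : R)
    (f : 'rV[R]_d -> R) : Prop :=
  forall x y, C x -> C y ->
    f y <= f x + dot (grad f x) (y - x) + L / 2 * enorm (y - x) ^+ 2.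

Definition argmin (R : realType) (d : nat) (f : 'rV[R]_d -> R)
    (C : set 'rV[R]_d) : set 'rV[R]_d :=
  [set x | C x /\ forall y, C y -> f x <= f y].

Definition is_min (R : realType) (A : set R) (m : R) : Prop :=
  A m /\ lbound A m.

Definition lmo_selector (R : realType) (d : nat) (C : set 'rV[R]_d)
    (S : 'rV[R]_d -> 'rV[R]_d) : Prop :=
  forall g, argmin (dot g) C (S g).

Definition frank_wolfe (R : realType) (d : nat) (f : 'rV[R]_d -> R)
    (S : 'rV[R]_d -> 'rV[R]_d) (gamma : nat -> R) (x : nat -> 'rV[R]_d) : Prop :=
  forall t, x t.+1 = x t + gamma t *: (S (grad f (x t)) - x t).

(* The direction space of aff(C): the smallest linear subspace containing all
   differences of points of C. *)
Definition dir_space (R : realType) (d : nat) (C : set 'rV[R]_d) :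
    set 'rV[R]_d :=
  [set v | forall U : {vspace 'rV[R]_d},
     (forall x y, C x -> C y -> x - y \in U) -> v \in U].

Definition is_dir_proj (R : realType) (d : nat) (C : set 'rV[R]_d)
    (g p : 'rV[R]_d) : Prop :=
  dir_space C p /\ forall v, dir_space C v -> dot (g - p) v = 0.

(* Orthogonal projection onto the direction space; see dir_projP below. *)
Definition dir_proj (R : realType) (d : nat) (C : set 'rV[R]_d)
    (g : 'rV[R]_d) : 'rV[R]_d :=
  xget 0 [set p | is_dir_proj C g p].

(* Local dual sharpness, read relative to aff(C): directions g are projected
   onto the direction space of C, and dir_proj C is the identity when C affinely
   spans R^d (dir_proj_id).  Without the projection a nonzero g orthogonal to a
   lower-dimensional C would force x = S g for all x in C near M.  The selector
   still receives the unprojected g, so that the iterates are those of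
   frank_wolfe; a selector acting on projected directions only is the special
   case of an S with S g = S (dir_proj C g). *)
Definition local_dual_sharpness (R : realType) (d : nat) (C : set 'rV[R]_d)
    (S : 'rV[R]_d -> 'rV[R]_d) (M : set 'rV[R]_d) (A q : R) : Prop :=
  exists2 rho : R, 0 < rho &
    forall x g, C x -> dist x M < rho ->
      A * enorm (dir_proj C g) * enorm (x - S g) `^ q
        <= dot (dir_proj C g) (x - S g).

Section dir_proj_theory.
Context {R : realType} {d : nat}.
Implicit Types (u v w g : 'rV[R]_d) (C : set 'rV[R]_d).

Lemma dotC u v : dot u v = dot v u.
Proof. by apply: eq_bigr => i _; rewrite mulrC. Qed.

Lemma dotDl u v w : dot (u + v) w = dot u w + dot v w.
Proof.
by rewrite /dot -big_split; apply: eq_bigr => i _; rewrite /= mxE mulrDl.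
Qed.

Lemma dotDr u v w : dot u (v + w) = dot u v + dot u w.
Proof. by rewrite ![dot u _]dotC dotDl. Qed.

Lemma dotZl a u w : dot (a *: u) w = a * dot u w.
Proof.
by rewrite /dot mulr_sumr; apply: eq_bigr => i _; rewrite mxE mulrA.
Qed.

Lemma dotBl u v w : dot (u - v) w = dot u w - dot v w.
Proof. by rewrite dotDl -scaleN1r dotZl mulN1r. Qed.

Lemma dotuu_eq0 u : dot u u = 0 -> u = 0.
Proof.
move=> /eqP; rewrite psumr_eq0 => [/allP u0|i _]; last by rewrite -expr2 sqr_ge0.
apply/rowP => i; rewrite mxE; apply/eqP.
by have := u0 i (mem_index_enum _); rewrite mulf_eq0 orbb.
Qed.

Lemma dot_span (X : seq 'rV[R]_d) u v :
  (forall x, x \in X -> dot u x = 0) -> v \in <<X>>%VS -> dot u v = 0.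
Proof.
move=> uX /(@coord_span _ _ _ (in_tuple X)) ->.
rewrite dotC; elim/big_ind: _ => [|y z|i _].
- by rewrite -(scale0r u) dotZl mul0r.
- by rewrite dotDl => -> ->; rewrite addr0.
- by rewrite dotZl dotC uX ?mulr0// mem_nth.
Qed.

Lemma span_proj (X : seq 'rV[R]_d) g :
  exists2 p, p \in <<X>>%VS & forall x, x \in X -> dot (g - p) x = 0.
Proof.
elim: X g => [|x X IH] g; first by exists 0; rewrite ?mem0v.
have [y yX xy] := IH x; have [p pX gp] := IH g.
pose r := x - y; pose c := dot (g - p) r / dot r r.
have sX : {subset <<X>>%VS <= <<x :: X>>%VS}.
  by apply/subvP; rewrite span_cons addvSr.
have xX : x \in <<x :: X>>%VS by rewrite memv_span// mem_head.
exists (p + c *: r).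
  by apply: memvD; [exact: sX|apply/memvZ/memvB => //; exact: sX].
have E z : dot (g - (p + c *: r)) z = dot (g - p) z - c * dot r z.
  by rewrite opprD addrA dotBl dotZl.
move=> z; rewrite inE => /orP[/eqP ->|zX]; last first.
  by rewrite E gp// xy// mulr0 subr0.
have xr u : (forall w, w \in X -> dot u w = 0) -> dot u x = dot u r.
  by move=> uX; rewrite -[x](subrK y) dotDr (dot_span uX yX) addr0.
rewrite E (xr _ gp) (xr _ xy) /c; have [r0|r0] := eqVneq (dot r r) 0.
  by rewrite r0 mulr0 subr0 (dotuu_eq0 r0) -(scale0r 0) dotC dotZl mul0r.
by rewrite divfK// subrr.
Qed.

Lemma dir_spaceE C : exists U : {vspace 'rV[R]_d},
  forall v, dir_space C v <-> v \in U.
Proof.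
pose P (U : {vspace 'rV[R]_d}) := forall x y, C x -> C y -> x - y \in U.
have exP : exists n, `[< exists2 U, P U & \dim U = n >].
  exists (\dim {:'rV[R]_d}); apply/asboolP.
  by exists fullv => // x y _ _; exact: memvf.
have [n /asboolP[U PU <-] minU] := ex_minnP exP.
exists U => v; split=> [/(_ U PU)//|vU V PV].
have UV : (U :&: V)%VS = U.
  apply/eqP; rewrite eqEdim capvSl minU//.
  apply/asboolP; exists (U :&: V)%VS => // x y Cx Cy.
  by rewrite memv_cap PU// PV.
by move: vU; rewrite -UV memv_cap => /andP[].
Qed.

Lemma dir_projP C g : is_dir_proj C g (dir_proj C g).
Proof.
have [U CU] := dir_spaceE C.
have [p pU gp] := span_proj (vbasis U) g.
rewrite /dir_proj; apply: (@xgetPex _ 0 [set p | is_dir_proj C g p]).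
have UE := span_basis (vbasisP U).
exists p; split=> [|v]; first by apply/CU; rewrite -UE.
by move=> /CU; rewrite -UE; exact: dot_span.
Qed.

Lemma dir_proj_id C g : dir_space C g -> dir_proj C g = g.
Proof.
move=> Cg; have [Cp gp] := dir_projP C g; apply/eqP; rewrite eq_sym -subr_eq0.
by apply/eqP/dotuu_eq0/gp => U CU; rewrite rpredB ?Cg ?Cp.
Qed.

End dir_proj_theory.

(* Main.v *)
(* Let h be the primal gap f (x t) - fstar, g the Frank-Wolfe gap, c the step
   size and r the distance from x t to the minimizers, so that r tends to 0 by
   the usual O(1/t) bound and compactness.  Convexity gives h <= g and
   h <= |p| r, where p is the projected gradient, which turns sharpness into
   |x - s|^q <= (r / A) (g / h).  As g / h >= 1 and q >= 2, |x - s|^2 is at most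
   a vanishing multiple of g / h.  Hence, for fixed e > 0 and large t, as long
   as h >= e c the quadratic term of the descent inequality is at most c g / 4 and
   h shrinks by the factor 1 - (3 / 4) c = 1 - 3 / (2 (t + 2)), which is faster
   than 1/t; and if h < e c, the next gap is at most 2 e c. *)

Require Import Defs.
From HB Require Import structures.
From mathcomp Require Import all_boot all_order all_algebra.
From mathcomp Require Import all_classical all_reals all_analysis.
From mathcomp Require Import ring lra.
Set Implicit Arguments.
Unset Strict Implicit.
Unset Printing Implicit Defensive.
Import Order.TTheory GRing.Theory Num.Theory numFieldNormedType.Exports.
Local Open Scope classical_set_scope.
Local Open Scope ring_scope.

(** * Euclidean norm, gradients of convex functions, and points close to the minimizers *)

Section Euclidean.
Context {R : realType} {d : nat}.
Implicit Types (u v w x y : 'rV[R]_d) (C : set 'rV[R]_d) (f : 'rV[R]_d -> R).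

Lemma dot_ge0 u : 0 <= dot u u.
Proof. by apply: sumr_ge0 => i _; rewrite -expr2 sqr_ge0. Qed.

Lemma enorm_ge0 u : 0 <= enorm u.
Proof. exact: sqrtr_ge0. Qed.

Lemma enorm_sqr u : enorm u ^+ 2 = dot u u.
Proof. by rewrite sqr_sqrtr ?dot_ge0. Qed.

Lemma dotZr a u v : dot u (a *: v) = a * dot u v.
Proof. by rewrite dotC dotZl dotC. Qed.

Lemma dot0l v : dot 0 v = 0.
Proof. by rewrite -(scale0r v) dotZl mul0r. Qed.

Lemma dotBr u v w : dot u (v - w) = dot u v - dot u w.
Proof. by rewrite dotC dotBl ![dot _ u]dotC. Qed.

Lemma enormN u : enorm (- u) = enorm u.
Proof. by rewrite /enorm -scaleN1r dotZl dotZr !mulN1r opprK. Qed.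

Lemma cauchy_schwarz u v : dot u v <= enorm u * enorm v.
Proof.
have [u0|u0] := eqVneq (enorm u) 0.
  have /dotuu_eq0 -> : dot u u = 0 by rewrite -enorm_sqr u0 expr0n.
  by rewrite dot0l mulr_ge0 ?enorm_ge0.
have a0 : 0 < enorm u by rewrite lt_def u0 enorm_ge0.
have [v0|v0] := eqVneq (enorm v) 0.
  have /dotuu_eq0 -> : dot v v = 0 by rewrite -enorm_sqr v0 expr0n.
  by rewrite dotC dot0l mulr_ge0 ?enorm_ge0.
have b0 : 0 < enorm v by rewrite lt_def v0 enorm_ge0.
(* With a = |u| and b = |v|, this square expands to 2ab(ab - <u, v>), and ab is positive. *)
have := dot_ge0 (enorm v *: u - enorm u *: v).
rewrite dotBl !dotBr !dotZl !dotZr -!enorm_sqr [dot v u]dotC.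
move: (enorm u) (enorm v) a0 b0 => a b a0 b0 h.
have ab : 0 < a * b by rewrite mulr_gt0.
rewrite -subr_ge0 -(pmulr_rge0 _ ab).
by nra.
Qed.

Lemma enorm_sqrB u v :
  enorm (u - v) ^+ 2 <= 2 * enorm u ^+ 2 + 2 * enorm v ^+ 2.
Proof.
have := dot_ge0 (u + v); rewrite !enorm_sqr dotBl !dotBr dotDl !dotDr.
rewrite [dot v u]dotC; lra.
Qed.

Lemma enorm_continuous : continuous (@enorm R d).
Proof.
move=> x; apply: (@continuous_comp _ _ _ (fun u => dot u u) Num.sqrt).
  rewrite /dot; apply: continuous_big; first exact: add_continuous.
  move=> i _ v.
  have ci : {for v, continuous (fun u : 'rV[R]_d => u 0 i)}.
    exact: (@coord_continuous R 1 d 0 i v).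
  exact: (continuousM ci ci).
exact: sqrt_continuous.
Qed.

Lemma compact_enorm_bounded C : compact C ->
  exists2 D, 0 < D & forall x y, C x -> C y -> enorm (x - y) ^+ 2 <= D.
Proof.
move=> Cc.
have /compact_bounded[N [Nr CN]] := continuous_compact
  (continuous_subspaceT enorm_continuous) Cc.
pose B := Num.max N 0 + 1.
have NB : N < B by rewrite ltr_pwDr// le_max lexx.
have B0 : 0 < B by rewrite ltr_pwDr// le_max lexx orbT.
have xB x : C x -> enorm x ^+ 2 <= B ^+ 2.
  move=> Cx; rewrite ler_sqr ?nnegrE ?enorm_ge0 ?(ltW B0)//.
  have /= := CN _ NB (enorm x).
  by rewrite ger0_norm ?enorm_ge0//; apply; exists x.
exists (4 * B ^+ 2) => [|x y Cx Cy]; first by rewrite mulr_gt0 ?exprn_gt0.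
have := enorm_sqrB x y; have := xB _ Cx; have := xB _ Cy; lra.
Qed.

Lemma derive_grad f x v : differentiable f x -> 'D_v f x = dot (grad f x) v.
Proof.
move=> fx; rewrite deriveE// /dot [in LHS](row_sum_delta v) linear_sum.
by apply: eq_bigr => i _; rewrite linearZ /= mxE deriveE// mulrC.
Qed.

(** Convexity on the segment from x to y bounds the difference quotients with 0 < h < 1 by f y - f
    x; the directional derivative is their limit from the right. *)
Lemma convex_grad_le f x y : convex_function setT f -> differentiable f x ->
  f x + dot (grad f x) (y - x) <= f y.
Proof.
move=> fcvx fx; rewrite addrC -lerBrDr -derive_grad//.
have /cvg_ex[l fl] := diff_derivable (v := y - x) fx.
rewrite /derive (cvg_lim _ fl)//.
have {}fl := cvg_dnbhs_at_right fl.
rewrite -(cvg_lim _ fl)//; apply: limr_le; first by apply/cvg_ex; exists l.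
near=> h; have h0 : 0 < h by near: h; exact: nbhs_right_gt.
have h1 : h < 1 by near: h; exact: nbhs_right_lt.
have := fcvx (Itv01 (ltW h0) (ltW h1)) y x (in_setT _) (in_setT _).
have -> : conv (Itv01 (ltW h0) (ltW h1)) (y : convex_lmodType _) x
          = h *: (y - x) + x.
  by rewrite /conv /= /unstable.onem scalerBl scalerBr scale1r addrA addrAC.
rewrite convRE /= /unstable.onem => fh.
rewrite /GRing.scale /= ler_pdivrMl//.
rewrite lerBlDr (le_trans fh)//; lra.
Unshelve. all: by end_near.
Qed.

(** The points of C at distance at least r from every minimizer form a compact set [K]. If [K] is
    nonempty, the minimum of f on it exceeds the minimum on C, and [e] is the difference. *)
Lemma near_argmin C f r : compact C -> continuous f -> 0 < r ->
  argmin f C !=set0 -> exists2 e, 0 < e & forall m x,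
    argmin f C m -> C x -> f x < f m + e ->
    exists2 y, argmin f C y & enorm (x - y) < r.
Proof.
move=> Cc fc r0 [m0 [Cm0 mf]].
pose F y : set 'rV[R]_d := (fun x => enorm (x - y)) @^-1` [set t | r <= t].
pose K := C `&` \bigcap_(y in argmin f C) F y.
have Kc : compact K.
  apply: compact_closedI => //; apply: closed_bigI => y _.
  apply: preimage_closed; last exact: closed_ge.
  move=> x _; apply: (@continuous_comp _ _ _ (fun u => u - y)).
    by apply: continuousB; [exact: cvg_id|exact: cst_continuous].
  exact: enorm_continuous.
have KP x : C x -> ~ K x -> exists2 y, argmin f C y & enorm (x - y) < r.
  move=> Cx nK; apply: contrapT => nE; apply: nK; split=> // y my.
  by rewrite /F /= leNgt; apply/negP => xy; apply: nE; exists y.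
have [K0|/set0P/negP/negPn/eqP K0] := pselect (K !=set0); last first.
  by exists 1 => // m x _ Cx _; apply: KP => //; rewrite K0.
have [z zK zf] := EVT_min_rV K0 Kc (continuous_subspaceT fc).
have {}zK : K z by rewrite inE in zK.
(* Otherwise [z] would itself be a minimizer, and [z] in [K] would have distance at least r to
   itself. *)
have fz m : argmin f C m -> f m < f z.
  move=> [Cm mm]; rewrite ltNge; apply/negP => zm.
  have [Cz /(_ z)] := zK; rewrite /F /= subrr.
  have -> : enorm (0 : 'rV[R]_d) = 0.
    by rewrite /enorm dot0l sqrtr0.
  rewrite leNgt r0 /= => H; suff : false by []; apply: H; split=> // y Cy.
  exact: le_trans zm (mm _ Cy).
exists (f z - f m0) => [|m x [Cm mm] Cx]; first by rewrite subr_gt0 fz.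
have -> : f m = f m0 by apply/le_anti; rewrite mm// mf.
rewrite addrC subrK => xz; apply: KP => // Kx.
have := zf x; rewrite inE => /(_ Kx); rewrite leNgt => /negP; exact.
Qed.

End Euclidean.

(** * Scalar recursions driven by the open-loop step size *)

Section Recursions.
Context {R : realType}.
Implicit Types (u w h : nat -> R).

(** If u stayed above a from N on, u + c * [series w] would be nonincreasing there and the series
    would converge. After a visit below a, every step either lands below b or does not increase
    u. *)
Lemma eventually_le_of_drift u w (N : nat) (a b c : R) :
  (forall t, 0 <= w t) -> ~ cvgn (series w) -> 0 < c -> a <= b ->
  (forall t, (N <= t)%N -> u t < a -> u t.+1 <= b) ->
  (forall t, (N <= t)%N -> a <= u t -> u t.+1 <= u t - c * w t) ->
  \forall t \near \oo, u t <= b.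
Proof.
move=> w0 wdvg c0 ab ulow uhigh.
have [t0 Nt0 ut0] : exists2 t, (N <= t)%N & u t < a.
  apply: contrapT => nlow; apply: wdvg.
  have ua t : (N <= t)%N -> a <= u t.
    by move=> Nt; rewrite leNgt; apply/negP => ?; apply: nlow; exists t.
  have drift k : u (N + k)%N + c * series w (N + k)%N <= u N + c * series w N.
    elim: k => [|k IH]; first by rewrite addn0.
    rewrite addnS seriesSr.
    have := uhigh _ (leq_addr k N) (ua _ (leq_addr k N)); lra.
  have incr : nondecreasing_seq (series w).
    by apply: nondecreasing_series => *; exact: w0.
  apply: nondecreasing_is_cvgn => //.
  exists ((u N + c * series w N - a) / c) => _ [n _ <-].
  rewrite ler_pdivlMr// mulrC.
  have := drift n; have := ua _ (leq_addr n N).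
  have : c * series w n <= c * series w (N + n)%N.
    by rewrite ler_pM2l// incr// leq_addl.
  lra.
exists t0.+1 => // t /= /subnK <-; elim: (t - t0.+1)%N => [|k IH].
  by rewrite add0n; apply: ulow.
rewrite addSn; have Nt : (N <= k + t0.+1)%N.
  by rewrite (leq_trans Nt0)// (leq_trans (leqnSn _))// leq_addl.
have [lo|hi] := ltP (u (k + t0.+1)%N) a; first exact: ulow.
apply: le_trans (uhigh _ Nt hi) _.
by rewrite lerBlDr (le_trans IH)// lerDl mulr_ge0// ltW.
Qed.

(** The step at t = 0 has size 1 and erases [h 0], so the bound involves B alone; from there on it
    is an induction. *)
Lemma open_loop_rate h (B : R) : 0 <= B ->
  (forall t, h t.+1 <= (1 - 2 / (t%:R + 2)) * h t +
                       B * (2 / (t%:R + 2)) ^+ 2) ->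
  forall t, h t.+1 <= 4 * B / (t%:R + 3).
Proof.
move=> B0 step; elim=> [|t IH].
  have := step 0%N; rewrite !add0r divff ?pnatr_eq0// subrr mul0r add0r.
  rewrite expr1n mulr1.
  by move=> /le_trans; apply; rewrite ler_pdivlMr//; lra.
apply: le_trans (step _) _; rewrite -[t.+1%:R]natr1.
have t0 : 0 <= t%:R :> R by [].
move: (t%:R : R) t0 IH => s s0 IH.
have e : 1 - 2 / (s + 1 + 2) = (s + 1) / (s + 3) by field; lra.
have s1 : 0 <= (s + 1) / (s + 3) by rewrite divr_ge0//; lra.
rewrite e; apply: le_trans (lerD (ler_wpM2l s1 IH) (lexx _)) _.
rewrite -subr_ge0.
(* The slack of the induction step in closed form, with a visible sign. *)
have -> : 4 * B / (s + 1 + 3) - ((s + 1) / (s + 3) * (4 * B / (s + 3)) +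
   B * (2 / (s + 1 + 2)) ^+ 2) = 4 * B / ((s + 4) * (s + 3) ^+ 2).
  by field; apply/andP; split; lra.
by rewrite divr_ge0 ?mulr_ge0 ?exprn_ge0//; lra.
Qed.

(* In terms of u t = (t + 2) h t, the first regime is u t < 2 e, and in the
   second one u drops by at least e / (t + 2), so that divergence of the
   harmonic series forces u back into the first. *)
Lemma open_loop_small h (N : nat) (e : R) : 0 < e ->
  (forall t, (N <= t)%N -> h t < e * (2 / (t%:R + 2)) ->
     h t.+1 <= 2 * (e * (2 / (t%:R + 2)))) ->
  (forall t, (N <= t)%N -> e * (2 / (t%:R + 2)) <= h t ->
     h t.+1 <= (1 - 3 / 4 * (2 / (t%:R + 2))) * h t) ->
  \forall t \near \oo, (t%:R + 2) * h t <= 8 * e.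
Proof.
move=> e0 low high.
(* From u t < 2e the next gap is at most 4e / (t + 2), and (t + 3) / (t + 2) <= 2 gives 8e. As
   [harmonic t] is 1 / (t + 1), the factor 1/2 absorbs the shift: e / (2(t + 1)) <= e / (t + 2). *)
apply: (@eventually_le_of_drift _ harmonic N (2 * e) (8 * e) (e / 2)).
- exact: harmonic_ge0.
- exact: dvg_harmonic.
- by rewrite divr_gt0.
- lra.
- move=> t Nt; have t0 : 0 <= t%:R :> R by [].
  have := low _ Nt; rewrite -[t.+1%:R]natr1.
  move: (t%:R : R) (h t) (h t.+1) t0 => s a b s0.
  have ec : e * (2 / (s + 2)) = 2 * e / (s + 2) by rewrite mulrCA mulrA.
  rewrite {1}ec ltr_pdivlMr; last lra.
  rewrite mulrC => H /H {}H.
  have e3 : 2 * (e * 2) = 2 * (e * (2 / (s + 2))) * (s + 2) by field; lra.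
  have b4 : b * (s + 2) <= 4 * e by have := ler_wpM2r (_ : 0 <= s + 2) H; lra.
  nra.
- move=> t Nt; have t0 : 0 <= t%:R :> R by [].
  have := high _ Nt; rewrite /harmonic /= -[t.+1%:R]natr1.
  move: (t%:R : R) (h t) (h t.+1) t0 => s a b s0.
  have ec : e * (2 / (s + 2)) = 2 * e / (s + 2) by rewrite mulrCA mulrA.
  rewrite {1}ec ler_pdivrMr; last lra.
  rewrite mulrC [a * _]mulrC => H ua; move/H: (ua) => {}H.
  have a0 : 0 < a by nra.
  have bs : b * (s + 2) <= (s + 1 / 2) * a.
    have -> : (s + 1 / 2) * a = (1 - 3 / 4 * (2 / (s + 2))) * a * (s + 2).
      by field; lra.
    by rewrite ler_pM2r//; lra.
  have es : e / 2 / (s + 1) <= a / 2 by rewrite ler_pdivrMr; nra.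
  have : b <= a by rewrite -(ler_pM2r (_ : 0 < s + 2)); lra.
  lra.
Qed.

End Recursions.

(** * A single Frank-Wolfe step and the effect of sharpness on its length *)

Section FrankWolfe.
Context {R : realType} {d : nat}.
Context (C : set 'rV[R]_d) (f : 'rV[R]_d -> R) (S : 'rV[R]_d -> 'rV[R]_d).
Implicit Types (m x y g : 'rV[R]_d).

Lemma dot_dir_proj g x y : C x -> C y ->
  dot (dir_proj C g) (x - y) = dot g (x - y).
Proof.
move=> Cx Cy; have [_ /(_ (x - y)) H] := dir_projP C g.
apply/esym/eqP; rewrite -subr_eq0 -dotBl H//.
by move=> U; apply.
Qed.

Lemma dist_le x y (M : set 'rV[R]_d) : M y -> dist x M <= enorm (x - y).
Proof.
move=> My; apply: ge_inf; last by exists y.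
by exists 0 => _ [z _ <-]; exact: enorm_ge0.
Qed.

Lemma fw_gap_ge m x : convex_function setT f -> differentiable f x ->
  lmo_selector C S -> C m ->
  f x - f m <= dot (grad f x) (x - S (grad f x)).
Proof.
move=> fcvx fx SC Cm; have [_ /(_ m Cm)] := SC (grad f x).
have := convex_grad_le m fcvx fx; rewrite !dotBr; lra.
Qed.

(* Convexity gives f x - f m <= |p| dist(x, M) for the projected gradient p, so
   near M sharpness bounds the q-th power of the step length by a small multiple
   of (gap / (f x - f m)); this ratio is >= 1, hence is at most its (q/2)-th
   power. *)
Lemma lds_step_le (A q k : R) : compact C -> convex_function setT f ->
  (forall x, differentiable f x) -> lmo_selector C S -> argmin f C !=set0 ->
  0 < A -> 2 <= q -> local_dual_sharpness C S (argmin f C) A q -> 0 < k ->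
  exists2 e, 0 < e & forall m x, argmin f C m -> C x ->
    f m < f x -> f x < f m + e ->
    (f x - f m) * enorm (x - S (grad f x)) ^+ 2
      <= k ^+ 2 * dot (grad f x) (x - S (grad f x)).
Proof.
move=> Cc fcvx fd SC M0 A0 q2 [rho rho0 lds] k0.
have q0 : 0 < q by lra.
have kq0 : 0 < k `^ q by rewrite powR_gt0.
(* The first bound makes sharpness applicable; the second leaves k^q once A is cancelled. *)
pose r := Num.min rho (A * k `^ q).
have r0 : 0 < r by rewrite lt_min rho0 mulr_gt0.
have fc : continuous f by move=> x; apply: differentiable_continuous.
have [e e0 near_M] := near_argmin Cc fc r0 M0.
exists e => // m x Mm Cx mx xe; have [y My xy] := near_M m x Mm Cx xe.
have [[Cm mf] [Cy yf]] := (Mm, My).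
have fy : f y = f m by apply/le_anti; rewrite yf// mf.
pose g := grad f x; pose p := dir_proj C g; pose s := S g.
have Cs : C s by case: (SC g).
have h0 : 0 < f x - f m by rewrite subr_gt0.
have hg : f x - f m <= dot g (x - s) by exact: fw_gap_ge.
have sharp : A * enorm p * enorm (x - s) `^ q <= dot g (x - s).
  rewrite -dot_dir_proj//; apply: lds => //.
  rewrite (le_lt_trans (dist_le x My))// (lt_le_trans xy)//.
  by rewrite ge_min lexx.
have hp : f x - f m <= enorm p * (A * k `^ q).
  have : f x - f m <= dot g (x - y).
    have := convex_grad_le y fcvx (fd x); rewrite -/g !dotBr fy; lra.
  rewrite -dot_dir_proj// => /le_trans; apply.
  apply: le_trans (cauchy_schwarz _ _) _; rewrite ler_wpM2l ?enorm_ge0//.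
  by rewrite ltW// (lt_le_trans xy)// ge_min lexx orbT.
have p0 : 0 < enorm p.
  rewrite lt_def enorm_ge0 andbT; apply/eqP => p0.
  by move: (lt_le_trans h0 hp); rewrite p0 mul0r ltxx.
(* Dividing by the primal gap leaves |x - s|^2 <= k^2 v, that is |x - s| <= k sqrt(v), which is
   checked on q-th powers. *)
rewrite -/g -/s mulrC -ler_pdivlMr// -mulrA.
pose v := dot g (x - s) / (f x - f m); rewrite -/v.
have v1 : 1 <= v by rewrite ler_pdivlMr// mul1r.
have v0 : 0 <= v by lra.
rewrite -[X in _ * X]sqr_sqrtr// -exprMn.
rewrite ler_sqr ?nnegrE ?mulr_ge0 ?enorm_ge0 ?sqrtr_ge0 ?(ltW k0)//.
rewrite leNgt; apply/negP => /(gt0_ltr_powR q0).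
rewrite !nnegrE !mulr_ge0 ?enorm_ge0 ?sqrtr_ge0 ?(ltW k0)// => /(_ isT isT).
apply/negP; rewrite -leNgt powRM ?sqrtr_ge0 ?(ltW k0)//.
have Ap : 0 < A * enorm p by rewrite mulr_gt0.
rewrite -(ler_pM2l Ap) (le_trans sharp)//.
(* Here q >= 2 enters: sqrt(v) >= 1, so its square is at most its q-th power. *)
have vq : v <= Num.sqrt v `^ q.
  rewrite -[X in X <= _]sqr_sqrtr// -powR_mulrn ?sqrtr_ge0//.
  by apply: ler_powR => //; rewrite -sqrtr1 ler_sqrt.
have -> : dot g (x - s) = (f x - f m) * v by rewrite mulrC divfK ?gt_eqF.
have -> : A * enorm p * (k `^ q * Num.sqrt v `^ q)
  = enorm p * (A * k `^ q) * Num.sqrt v `^ q by ring.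
by rewrite ler_pM// ltW.
Qed.

Lemma fw_step_mem x (c : R) : convex_set C -> lmo_selector C S -> C x ->
  0 <= c <= 1 -> C (x + c *: (S (grad f x) - x)).
Proof.
move=> Ccvx SC Cx /andP[c0 c1]; have [Cs _] := SC (grad f x).
have := Ccvx _ _ (Itv01 c0 c1) (mem_set Cs) (mem_set Cx).
rewrite inE; congr (C _).
by rewrite /conv /= /unstable.onem scalerBl scalerBr scale1r addrCA.
Qed.

Lemma fw_descent x (L c : R) : smooth_on C L f -> C x ->
  C (x + c *: (S (grad f x) - x)) ->
  f (x + c *: (S (grad f x) - x)) <= f x
    - c * dot (grad f x) (x - S (grad f x))
    + L / 2 * c ^+ 2 * enorm (x - S (grad f x)) ^+ 2.
Proof.
move=> fL Cx Cy; apply: le_trans (fL _ _ Cx Cy) _.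
have -> : x + c *: (S (grad f x) - x) - x = - (c *: (x - S (grad f x))).
  by rewrite addrAC subrr add0r -scalerN opprB.
by rewrite enormN -scaleNr dotZr mulNr !enorm_sqr dotZl dotZr expr2 !mulrA.
Qed.

End FrankWolfe.

Theorem theorem3p10 (R : realType) (d : nat) (C : set 'rV[R]_d)
    (C0 : C !=set0) (Ccompact : compact C) (Cconvex : convex_set C)
    (f : 'rV[R]_d -> R) (fconvex : convex_function setT f)
    (fC1 : continuously_differentiable f)
    (L : R) (L0 : 0 < L) (fL : smooth_on C L f)
    (fstar : R) (fstar_min : is_min (f @` C) fstar)
    (S : 'rV[R]_d -> 'rV[R]_d) (SC : lmo_selector C S)
    (A q : R) (A0 : 0 < A) (q2 : 2 <= q)
    (lds : local_dual_sharpness C S (argmin f C) A q)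
    (x : nat -> 'rV[R]_d) (x0C : C (x 0%N))
    (xFW : frank_wolfe f S (fun t => 2 / (t%:R + 2)) x) :
  (fun t : nat => f (x t) - fstar) =o_\oo (fun t : nat => t%:R^-1 : R).
Proof.
have [fd _] := fC1; have [[m Cm fm] mlb] := fstar_min.
have mf y : C y -> f m <= f y by move=> Cy; rewrite fm; apply: mlb; exists y.
have Mm : argmin f C m by [].
have [D D0 CD] := compact_enorm_bounded Ccompact.
pose c t : R := 2 / (t%:R + 2).
have t2 t : 0 < t%:R + 2 :> R by rewrite ltr_wpDl.
have c0 t : 0 < c t by rewrite divr_gt0.
have c1 t : c t <= 1 by rewrite ler_pdivrMr// mul1r lerDr.
have step t : x t.+1 = x t + c t *: (S (grad f (x t)) - x t) by exact: xFW.
have Cx t : C (x t).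
  elim: t => // t Cxt; rewrite step.
  by apply: (@fw_step_mem _ _ C) => //; rewrite ltW /=.
pose h t := f (x t) - fstar; pose s t := S (grad f (x t)).
pose g t := dot (grad f (x t)) (x t - s t).
have h0 t : 0 <= h t by rewrite subr_ge0 -fm mf.
have hg t : h t <= g t by rewrite /h -fm; exact: fw_gap_ge.
have descent t : h t.+1 <= h t - c t * g t
    + L / 2 * c t ^+ 2 * enorm (x t - s t) ^+ 2.
  have := Cx t.+1; rewrite /h step => Cx1.
  by have := fw_descent fL (Cx t) Cx1; rewrite -/(s t) -/(g t); lra.
have dD t : enorm (x t - s t) ^+ 2 <= D.
  by apply: CD => //; case: (SC (grad f (x t))).
(* Bounding the step length by the diameter alone gives the O(1/t) rate that brings the iterates to
   where sharpness acts. *)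
have descentD t : h t.+1 <= (1 - c t) * h t + L / 2 * D * c t ^+ 2.
  have : c t * h t <= c t * g t by rewrite ler_pM2l.
  have : L / 2 * c t ^+ 2 * enorm (x t - s t) ^+ 2 <= L / 2 * c t ^+ 2 * D.
    by rewrite ler_pM2l ?dD// mulr_gt0 ?exprn_gt0 ?divr_gt0.
  have := descent t; lra.
have LD0 : 0 <= L / 2 * D by rewrite mulr_ge0 ?divr_ge0 ?ltW.
have rate := open_loop_rate LD0 descentD.
(* The 8 matches the bound 8e of [open_loop_small]. *)
apply/eqoP => eps eps0 /=; pose e := eps / 8.
have e0 : 0 < e by rewrite divr_gt0.
(* Chosen so that (L / 2) c^2 k^2 g / h = (c g / 4)(e c / h), which is at most c g / 4 when h >= e
   c. *)
have [k k0 kE] : exists2 k : R, 0 < k & k ^+ 2 = e / (2 * L).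
  have ke : 0 < e / (2 * L) by rewrite divr_gt0 ?mulr_gt0.
  by exists (Num.sqrt (e / (2 * L))); rewrite ?sqrtr_gt0// sqr_sqrtr// ltW.
have [del del0 step_le] := lds_step_le Ccompact fconvex fd SC
  (ex_intro _ m Mm) A0 q2 lds k0.
(* The first condition serves the regime h >= e c through [step_le], the second the regime h < e
   c. *)
have [N _ NP] : \forall t \near \oo,
    h t < del /\ L * D / 2 * c t <= e.
  near=> t; split.
    have t0 : (0 < t)%N by near: t; exact: nbhs_infty_gt.
    have tB : 4 * (L / 2 * D) / del <= t%:R by near: t; exact: nbhs_infty_ger.
    (* [rate] bounds the gap only at successors, hence the passage through the predecessor of t. *)
    move: tB; rewrite -(prednK t0) => tB; apply: le_lt_trans (rate _) _.
    rewrite ltr_pdivrMr ?ltr_wpDl// [del * _]mulrC -ltr_pdivrMr//.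
    by rewrite (le_lt_trans tB)// -[X in X < _]natr1 ltrD2l; lra.
  rewrite /c mulrA divfK// ler_pdivrMr// [e * _]mulrC -ler_pdivrMr//.
  have tD : L * D / e <= t%:R by near: t; exact: nbhs_infty_ger.
  by rewrite (le_trans tD)// lerDl.
have low t : (N <= t)%N -> h t < e * c t -> h t.+1 <= 2 * (e * c t).
  move=> /NP[_ ce] ht.
  have : L * D / 2 * c t * c t <= e * c t by rewrite ler_pM2r.
  have : 0 <= c t * h t by rewrite mulr_ge0// ltW.
  have := descentD t; lra.
have high t : (N <= t)%N -> e * c t <= h t -> h t.+1 <= (1 - 3 / 4 * c t) * h t.
  move=> /NP[hdel _] ht.
  have hp : 0 < h t by rewrite (lt_le_trans _ ht)// mulr_gt0.
  have hd : h t * enorm (x t - s t) ^+ 2 <= e / (2 * L) * g t.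
    rewrite -kE /h -fm; apply: step_le => //; rewrite fm.
      by rewrite -subr_gt0.
    by rewrite -ltrBlDl.
  have g0 : 0 < g t := lt_le_trans hp (hg t).
  have quad : L / 2 * c t ^+ 2 * enorm (x t - s t) ^+ 2 <= c t * g t / 4.
    (* Multiplying by [h t] produces the product that [hd] controls. *)
    rewrite -(ler_pM2r hp).
    have : L / 2 * c t ^+ 2 * (h t * enorm (x t - s t) ^+ 2)
        <= L / 2 * c t ^+ 2 * (e / (2 * L) * g t).
      by rewrite ler_pM2l// mulr_gt0 ?exprn_gt0 ?divr_gt0.
    have -> : L / 2 * c t ^+ 2 * (e / (2 * L) * g t)
        = c t * g t / 4 * (e * c t).
      by field; rewrite gt_eqF.
    have : c t * g t / 4 * (e * c t) <= c t * g t / 4 * h t.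
      by rewrite ler_pM2l// divr_gt0 ?mulr_gt0.
    lra.
  have : c t * h t <= c t * g t by rewrite ler_pM2l.
  have := descent t; lra.
near=> t.
have t0 : (0 < t)%N by near: t; exact: nbhs_infty_gt.
have t0R : 0 < t%:R :> R by rewrite ltr0n.
have /= : (t%:R + 2) * h t <= 8 * e.
  by near: t; exact: open_loop_small e0 low high.
rewrite -/(h t) ger0_norm// normfV ger0_norm ?(ltW t0R)// ler_pdivlMr//.
have := h0 t.
rewrite /e; lra.
Unshelve. all: by end_near.
Qed.
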